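(* A language $L$ is recursively enumerable if and only if $L=L(G,F)$ for some propagating context-free grammar $G=(V,T,P,S)$ with $\{0,1,\#\}\subseteq V$, where $F=\{w\#w^R\mid w\in\{0,1\}^*\}$ and the finalizing alphabet is $W=\{0,1,\#\}$.
   Context: A context-free grammar $G=(V,T,P,S)$ has total alphabet $V$, terminals $T\subseteq V$, nonterminals $N=V-T$, finite rules $P\subseteq N\times V^*$, start $S\in N$; it is propagating if every rule $A\to x$ has $x\neq\varepsilon$. $\phi(G)=\{w\in V^*\mid S\Rightarrow^*w\}$. For $X\subseteq V$, $\pi_X$ is the homomorphism from $V^*$ to $X^*$ keeping symbols of $X$ and erasing the others. For $W\subseteq V$ and $F\subseteq W^*$, $\phi(G,F)=\{x\in\phi(G)\mid\pi_W(x)\in F\}$ and $L(G,F)=\{\pi_T(y)\mid y\in\phi(G,F),\ \pi_{N-W}(y)=\varepsilon\}$. $w^R$ denotes the reversal of $w$. *)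

(* Defs.v *)
From mathcomp Require Import all_boot.
Set Implicit Arguments. Unset Strict Implicit. Unset Printing Implicit Defensive.

(* Total alphabet of a grammar with terminal alphabet Sigma and
   nonterminal alphabet N is the disjoint sum Sigma + N:
   terminals are the [inl a], nonterminals the [inr A]. *)

Definition has_nonterminal (Sigma N : Type) (x : seq (Sigma + N)) : bool :=
  has (fun s => if s is inr _ then true else false) x.

Definition ps_step (Sigma N : eqType) (P : seq (seq (Sigma + N) * seq (Sigma + N)))
  (x y : seq (Sigma + N)) : Prop :=
  exists u v l r, (l, r) \in P /\ x = u ++ l ++ v /\ y = u ++ r ++ v.

Inductive ps_derives (Sigma N : eqType) (P : seq (seq (Sigma + N) * seq (Sigma + N)))
  : seq (Sigma + N) -> seq (Sigma + N) -> Prop :=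
| ps_refl x : ps_derives P x x
| ps_trans x y z : ps_step P x y -> ps_derives P y z -> ps_derives P x z.

Definition recursively_enumerable (Sigma : finType) (L : seq Sigma -> Prop) : Prop :=
  exists (N : finType) (P : seq (seq (Sigma + N) * seq (Sigma + N))) (S : N),
    (forall l r, (l, r) \in P -> has_nonterminal l) /\
    (forall w, L w <-> ps_derives P [:: inr S] (map inl w)).

Definition cf_step (Sigma N : eqType) (P : seq (N * seq (Sigma + N)))
  (x y : seq (Sigma + N)) : Prop :=
  exists u v A r, (A, r) \in P /\ x = u ++ inr A :: v /\ y = u ++ r ++ v.

Inductive cf_derives (Sigma N : eqType) (P : seq (N * seq (Sigma + N)))
  : seq (Sigma + N) -> seq (Sigma + N) -> Prop :=
| cf_refl x : cf_derives P x x
| cf_trans x y z : cf_step P x y -> cf_derives P y z -> cf_derives P x z.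

Definition propagating (Sigma N : eqType) (P : seq (N * seq (Sigma + N))) : Prop :=
  forall A r, (A, r) \in P -> r <> [::].

Definition phi (Sigma N : eqType) (P : seq (N * seq (Sigma + N))) (S : N)
  (w : seq (Sigma + N)) : Prop := cf_derives P [:: inr S] w.

Definition pi_T (Sigma N : Type) (y : seq (Sigma + N)) : seq Sigma :=
  pmap (fun s => if s is inl a then Some a else None) y.

Definition pi_X (V : eqType) (X : seq V) (y : seq V) : seq V :=
  filter (fun s => s \in X) y.

Definition pi_NminusW (Sigma N : eqType) (W : seq (Sigma + N)) (y : seq (Sigma + N))
  : seq (Sigma + N) :=
  [seq s <- y | (if s is inr _ then true else false) && (s \notin W)].

Definition F_mirror (V : eqType) (z o h : V) (u : seq V) : Prop :=
  exists w : seq V, all (fun s => s \in [:: z; o]) w /\ u = w ++ h :: rev w.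

Definition L_GF (Sigma N : eqType) (P : seq (N * seq (Sigma + N))) (S : N)
  (z o h : Sigma + N) (w : seq Sigma) : Prop :=
  exists y, [/\ phi P S y,
    F_mirror z o h (pi_X [:: z; o; h] y),
    pi_NminusW [:: z; o; h] y = [::]
  & pi_T y = w].

(* Main.v *)
(** From L(G,F) to a phrase-structure grammar: simulate G on pending copies of
    its symbols, replace each finished symbol of W by a mark (next to the
    terminal it may be), let the marks move left past the terminals, cancel the
    pairs of equal marks around #, and erase # against a unique left end.
    Soundness is an induction on the derivation read backwards.

    Conversely, a derivation x_0 => ... => x_n is a match of a Post
    correspondence system whose tops spell x_0 $ ... $ x_n $ and whose bottoms
    run one sentential form ahead.  A linear grammar that generates the tops to
    the left of # and the reversed bottoms to the right, binary coded over 0 and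
    1, turns the match into the mirror condition; the letters of x_n are emitted
    with their codes, and the nonterminal present in every right-hand side makes
    the grammar propagating. *)

Require Import Defs.
From mathcomp Require Import all_boot.
Set Implicit Arguments.
Unset Strict Implicit.
Unset Printing Implicit Defensive.

(** * Derivations under composition, in context and side by side *)

Section Derivations.

Variables Sigma N : eqType.

Section PhraseStructure.

Variable P : seq (seq (Sigma + N) * seq (Sigma + N)).

Lemma ps_derives_comp x y z :
  ps_derives P x y -> ps_derives P y z -> ps_derives P x z.
Proof.
by elim=> // x1 y1 z1 st _ IH /IH; apply: ps_trans.
Qed.

Lemma ps_derives_ctx u v x y :
  ps_derives P x y -> ps_derives P (u ++ x ++ v) (u ++ y ++ v).
Proof.
elim=> [x1|x1 y1 z1 [u1 [v1 [l [r [lr [-> ->]]]]]] _ IH]; first exact: ps_refl.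
apply: ps_trans IH; exists (u ++ u1), (v1 ++ v), l, r.
by rewrite -!catA.
Qed.

Lemma ps_derives_ctxl u x y :
  ps_derives P x y -> ps_derives P (u ++ x) (u ++ y).
Proof. by move/(ps_derives_ctx u [::]); rewrite !cats0. Qed.

Lemma ps_derives_ctxr v x y :
  ps_derives P x y -> ps_derives P (x ++ v) (y ++ v).
Proof. exact: (ps_derives_ctx [::] v). Qed.

Lemma ps_derives_rule l r : (l, r) \in P -> ps_derives P l r.
Proof.
move=> lr; apply: ps_trans (ps_refl _ _).
by exists [::], [::], l, r; rewrite !cats0.
Qed.

End PhraseStructure.

Section ContextFree.

Variable P : seq (N * seq (Sigma + N)).

Lemma cf_derives_comp x y z :
  cf_derives P x y -> cf_derives P y z -> cf_derives P x z.
Proof.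
by elim=> // x1 y1 z1 st _ IH /IH; apply: cf_trans.
Qed.

Lemma cf_derives_ctx u v x y :
  cf_derives P x y -> cf_derives P (u ++ x ++ v) (u ++ y ++ v).
Proof.
elim=> [x1|x1 y1 z1 [u1 [v1 [A [r [Ar [-> ->]]]]]] _ IH]; first exact: cf_refl.
apply: cf_trans IH; exists (u ++ u1), (v1 ++ v), A, r.
by rewrite -!catA.
Qed.

Lemma cf_derives_cat x1 y1 x2 y2 :
  cf_derives P x1 y1 -> cf_derives P x2 y2 ->
  cf_derives P (x1 ++ x2) (y1 ++ y2).
Proof.
move=> /(cf_derives_ctx [::] x2) d1 /(cf_derives_ctx y1 [::]).
by rewrite !cats0; apply: cf_derives_comp.
Qed.

Lemma cf_step_rule A r u v :
  (A, r) \in P -> cf_step P (u ++ inr A :: v) (u ++ r ++ v).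
Proof. by exists u, v, A, r. Qed.

End ContextFree.

End Derivations.

(** * From context-free grammars with mirror finalization to phrase-structure grammars *)

Section LGFisRE.

Variables (Sigma N : finType) (P : seq (N * seq (Sigma + N))) (S : N).
Variables z o h : Sigma + N.
Hypothesis uniq_zoh : uniq [:: z; o; h].

Local Notation V := (Sigma + N)%type.
Local Notation W := [:: z; o; h].

Definition sim_nt : finType := (V + V + bool)%type.
Definition pending (v : V) : Sigma + sim_nt := inr (inl (inl v)).
Definition mark (v : V) : Sigma + sim_nt := inr (inl (inr v)).
Definition start : sim_nt := inr true.
Definition left_end : Sigma + sim_nt := inr (inr false).

(** A finalizing symbol may itself be a terminal and then leaves both a mark and a letter. A
    nonterminal outside [W] would leave nothing, so [sim_rules] finishes only symbols that pass
    [finished]. *)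
Definition finish1 (v : V) : seq (Sigma + sim_nt) :=
  (if v \in W then [:: mark v] else [::]) ++
  (if v is inl a then [:: inl a] else [::]).
Definition finish (y : seq V) := flatten (map finish1 y).

Definition finished (y : seq V) : bool := pi_NminusW W y == [::].

Definition sim_rules : seq (seq (Sigma + sim_nt) * seq (Sigma + sim_nt)) :=
  [:: ([:: inr start], [:: left_end; pending (inr S)])]
  ++ [seq ([:: pending (inr p.1)], map pending p.2) | p <- P]
  ++ [seq ([:: pending v], finish1 v) | v <- enum (V : finType) & finished [:: v]]
  ++ [seq ([:: inl a; mark v], [:: mark v; inl a]) | a <- enum Sigma, v <- W]
  ++ [seq ([:: mark c; mark h; mark c], [:: mark h]) | c <- [:: z; o]]
  ++ [:: ([:: left_end; mark h], [::])].

Lemma sim_rulesP l r : (l, r) \in sim_rules ->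
  [\/ l = [:: inr start] /\ r = [:: left_end; pending (inr S)],
      exists A x, [/\ (A, x) \in P, l = [:: pending (inr A)] & r = map pending x],
      exists v, [/\ finished [:: v], l = [:: pending v] & r = finish1 v]
   |  [\/ exists a v, [/\ v \in W, l = [:: inl a; mark v] & r = [:: mark v; inl a]],
      exists c, [/\ c \in [:: z; o], l = [:: mark c; mark h; mark c] & r = [:: mark h]]
   |  l = [:: left_end; mark h] /\ r = [::]]].
Proof.
rewrite !mem_cat => /orP[|/orP[|/orP[|/orP[|/orP[]]]]].
- by rewrite inE => /eqP[-> ->]; constructor 1.
- by case/mapP=> -[A x] Ax [-> ->]; constructor 2; exists A, x.
- case/mapP=> v; rewrite mem_filter => /andP[fv _] [-> ->].
  by constructor 3; exists v.
- by case/allpairsP=> -[a v] /= [_ vW [-> ->]]; constructor 4; constructor 1; exists a, v.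
- by case/mapP=> c cW [-> ->]; constructor 4; constructor 2; exists c.
- by rewrite inE => /eqP[-> ->]; constructor 4; constructor 3.
Qed.

Lemma sim_rules_nonterminal l r : (l, r) \in sim_rules -> has_nonterminal l.
Proof.
case/sim_rulesP => [[-> _]|[A [x [_ -> _]]]|[v [_ -> _]]|] //.
by case=> [[a [v [_ -> _]]]|[c [_ -> _]]|[-> _]].
Qed.

(** * Soundness of the simulation *)

Definition marks (t : seq (Sigma + sim_nt)) : seq sim_nt :=
  pmap (fun s => if s is inr A then Some A else None) t.

Lemma marks_cat t1 t2 : marks (t1 ++ t2) = marks t1 ++ marks t2.
Proof. exact: pmap_cat. Qed.

Lemma pi_T_cat (M : Type) (t1 t2 : seq (Sigma + M)) :
  pi_T (t1 ++ t2) = pi_T t1 ++ pi_T t2.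
Proof. exact: pmap_cat. Qed.

Lemma finish_cat x y : finish (x ++ y) = finish x ++ finish y.
Proof. by rewrite /finish map_cat flatten_cat. Qed.

Lemma finished_cat x y : finished (x ++ y) = finished x && finished y.
Proof.
rewrite /finished /pi_NminusW filter_cat.
by case: [seq s <- x | _].
Qed.

Lemma pi_T_finish y : pi_T (finish y) = pi_T y.
Proof.
elim: y => //= v y IH; rewrite /finish /= -/(finish y) pi_T_cat IH /finish1.
by case: ifP; case: v.
Qed.

Lemma marks_finish y : marks (finish y) = [seq inl (inr v) | v <- pi_X W y].
Proof.
elim: y => //= v y IH; rewrite /finish /= -/(finish y) marks_cat IH /finish1.
by case: ifP; case: v.
Qed.

(* [gen x t]: the pending symbols of x can be developed by the context-free
   rules and finished, yielding t; the start symbol stands for all outcomes of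
   the simulated grammar. *)
Definition gen1 (s : Sigma + sim_nt) (t : seq (Sigma + sim_nt)) : Prop :=
  match s with
  | inr (inl (inl v)) =>
      exists y, [/\ cf_derives P [:: v] y, finished y & t = finish y]
  | inr (inr true) =>
      exists y, [/\ phi P S y, finished y & t = left_end :: finish y]
  | _ => t = [:: s]
  end.

Fixpoint gen (x t : seq (Sigma + sim_nt)) : Prop :=
  if x is s :: x' then
    exists t1 t2, [/\ t = t1 ++ t2, gen1 s t1 & gen x' t2]
  else t = [::].

Lemma gen_cat x1 x2 t :
  gen (x1 ++ x2) t <-> exists t1 t2, [/\ t = t1 ++ t2, gen x1 t1 & gen x2 t2].
Proof.
elim: x1 t => [|s x1 IH] t /=.
  split=> [g|[t1 [t2 [-> -> //]]]]; by exists [::], t.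
split=> [[t1 [t' [-> g1 /IH[t2 [t3 [-> g2 g3]]]]]]|].
  exists (t1 ++ t2), t3; split; rewrite ?catA //.
  by exists t1, t2.
case=> _ [t3 [-> [t1 [t2 [-> g1 g2]]] g3]].
exists t1, (t2 ++ t3); split; rewrite ?catA //.
by apply/IH; exists t2, t3.
Qed.

Lemma gen_seq1 s t : gen [:: s] t <-> gen1 s t.
Proof.
split=> [[t1 [t2 [-> g ->]]]|g]; first by rewrite cats0.
by exists t, [::]; rewrite cats0.
Qed.

Lemma gen_pending x t : gen (map pending x) t ->
  exists y, [/\ cf_derives P x y, finished y & t = finish y].
Proof.
elim: x t => [|v x IH] t /=.
  by move->; exists [::]; split=> //; apply: cf_refl.
case=> _ [_ [-> [y1 [d1 f1 ->]] /IH[y2 [d2 f2 ->]]]].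
exists (y1 ++ y2); rewrite finished_cat f1 f2 finish_cat; split=> //.
exact: (@cf_derives_cat _ _ P [:: v]).
Qed.

Definition inert (s : Sigma + sim_nt) : bool :=
  match s with inr (inl (inl _)) | inr (inr true) => false | _ => true end.

Lemma gen_inert x t : all inert x -> gen x t <-> t = x.
Proof.
elim: x t => //= s x IH t /andP[si xi].
split=> [[t1 [t2 [-> g1 /(IH _ xi) ->]]]|->].
  by case: s si g1 => [a|[[v|v]|[]]] //= _ ->.
exists [:: s], x; split=> //; last exact/IH.
by case: s si => [a|[[v|v]|[]]].
Qed.

Lemma finish1_inert v : all inert (finish1 v).
Proof. by rewrite /finish1; case: ifP; case: v. Qed.

(** The start symbol is counted as well because it turns into a left end; thus only the erasing rule
    changes the count. *)
Definition ends (x : seq (Sigma + sim_nt)) : nat :=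
  count (fun s => if s is inr (inr _) then true else false) x.

Lemma ends_cat x y : ends (x ++ y) = ends x + ends y.
Proof. exact: count_cat. Qed.

Lemma ends_pending x : ends (map pending x) = 0.
Proof. by elim: x. Qed.

Lemma ends_finish1 v : ends (finish1 v) = 0.
Proof. by rewrite /finish1; case: ifP; case: v. Qed.

Lemma ends_finish y : ends (finish y) = 0.
Proof.
by elim: y => //= v y IH; rewrite /finish /= -/(finish y) ends_cat IH ends_finish1.
Qed.

Lemma gen_ends x t : gen x t -> ends t = ends x.
Proof.
elim: x t => [|s x IH] t; first by move->.
case=> t1 [t2 [-> g1 /IH e]]; rewrite ends_cat e -cat1s ends_cat; congr addn.
case: s g1 => [a|[[v|v]|[]]] /=; try by move->.
  by case=> y [_ _ ->]; apply: ends_finish.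
by case=> y [_ _ ->] /=; rewrite -/(ends _) ends_finish.
Qed.

Lemma ends_marks t : ends t = count (fun A : sim_nt => if A is inr _ then true else false) (marks t).
Proof. by elim: t => //= -[a|[A|b]] t /= ->. Qed.

Definition balanced (m : seq sim_nt) : Prop :=
  exists2 u : seq V, all (mem [:: z; o]) u &
    m = inr false :: [seq inl (inr v) | v <- u ++ h :: rev u].

(* No mark is left exactly when the erasing rule has already been applied. *)
Definition good (w : seq Sigma) (x : seq (Sigma + sim_nt)) : Prop :=
  exists t, [/\ gen x t, pi_T t = w & marks t = [::] \/ balanced (marks t)].

(** Covers every rule that preserves the letters and the marks of the outcome; cancellation and
    erasure change the marks and are treated apart. *)
Lemma good_replace w u v l r :
  (forall t, gen r t -> exists t', [/\ gen l t', pi_T t' = pi_T t & marks t' = marks t]) ->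
  good w (u ++ r ++ v) -> good w (u ++ l ++ v).
Proof.
move=> lr; case=> _ [/gen_cat[t1 [_ [-> g1 /gen_cat[t2 [t3 [-> g2 g3]]]]]] <- mt].
have [t' [g' eT em]] := lr _ g2.
exists (t1 ++ t' ++ t3); split.
- apply/gen_cat; exists t1, (t' ++ t3); split=> //.
  by apply/gen_cat; exists t', t3.
- by rewrite !pi_T_cat eT.
- by rewrite !marks_cat em; rewrite !marks_cat in mt.
Qed.

(** Letters and marks are read off separately, so their relative order is invisible to [good]. *)
Lemma good_swap w u v a c :
  good w (u ++ [:: mark c; inl a] ++ v) -> good w (u ++ [:: inl a; mark c] ++ v).
Proof.
apply: good_replace => t /gen_inert -> //.
by exists [:: inl a; mark c]; split=> //; apply/gen_inert.
Qed.

(** The visible mark of [h] rules out the case without marks. Since [h] differs from [z] and [o], a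
    balanced sequence has only one such mark, so this one is the centre, and a pair of [c] around it
    extends the word [u] of [balanced] at its end. *)
Lemma good_check w u v c : c \in [:: z; o] ->
  good w (u ++ [:: mark h] ++ v) -> good w (u ++ [:: mark c; mark h; mark c] ++ v).
Proof.
move=> czo [_ [/gen_cat[t1 [_ [-> g1 /gen_cat[_ [t3 [-> /gen_inert -> // g3]]]]]] <- mt]].
exists (t1 ++ [:: mark c; mark h; mark c] ++ t3); split.
- apply/gen_cat; exists t1, ([:: mark c; mark h; mark c] ++ t3); split=> //.
  by apply/gen_cat; exists [:: mark c; mark h; mark c], t3; split=> //; apply/gen_inert.
- by rewrite !pi_T_cat.
right; move: mt; rewrite !marks_cat => -[|[w0 w0zo]] /=; first by case: (marks t1).
have hw s : all (mem [:: z; o]) s -> inl (inr h) \notin [seq inl (inr v0) : sim_nt | v0 <- s].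
  move=> /allP sP; apply/mapP=> -[v0 /sP /= v0s [hv0]].
  by move: uniq_zoh v0s; rewrite -hv0 /= !inE !(eq_sym h) => /and3P[/norP[_ /negPf->] /negPf->].
rewrite map_cat /= -cat_cons => /eqP.
rewrite eqseq_pivotr ?in_cons ?hw ?all_rev //.
case/andP=> /eqP -> /eqP ->; exists (rcons w0 c); first by rewrite all_rcons /= czo.
by rewrite rev_rcons /= map_cat map_rcons /= -cats1 -catA.
Qed.

(** With no left end in the context the outcome cannot be balanced, hence it has no marks; restoring
    the erased pair gives the balanced sequence of the empty word. *)
Lemma good_erase w u v : ends (u ++ v) = 0 ->
  good w (u ++ v) -> good w (u ++ [:: left_end; mark h] ++ v).
Proof.
move=> e0 [t [g eT mt]]; have e0' := gen_ends g.
case: mt => [m0|[w0 _ m0]]; last by move: e0'; rewrite e0 ends_marks m0.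
have /gen_cat[t1 [t2 [def_t g1 g2]]] := g; rewrite {t}def_t in m0 eT {g e0'}.
exists (t1 ++ [:: left_end; mark h] ++ t2); split.
- apply/gen_cat; exists t1, ([:: left_end; mark h] ++ t2); split=> //.
  by apply/gen_cat; exists [:: left_end; mark h], t2; split=> //; apply/gen_inert.
- by rewrite -eT !pi_T_cat.
right; exists [::] => //; move: m0; rewrite !marks_cat /=.
by case: (marks t1) => //= ->.
Qed.

(** The bound on [ends] travels forwards along the derivation while [good] travels backwards; the
    bound ensures that an erasure removes the only left end. *)
Lemma good_step w x y : ends x <= 1 -> ps_step sim_rules x y ->
  ends y <= 1 /\ (good w y -> good w x).
Proof.
move=> ex [u [v [l [r [/sim_rulesP lr [def_x def_y]]]]]].
move: ex; rewrite {x}def_x {y}def_y.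
rewrite !ends_cat; case: lr => [[-> ->]|[A [x [Ax -> ->]]]|[c [fc -> ->]]|].
- move=> ex; split=> //; apply: good_replace => _ [_ [_ [-> -> /gen_seq1[y [d f ->]]]]].
  by exists (left_end :: finish y); split=> //; apply/gen_seq1; exists y.
- rewrite ends_pending => ex; split=> //; apply: good_replace => _ /gen_pending[y [d f ->]].
  exists (finish y); split=> //; apply/gen_seq1; exists y; split=> //.
  by apply: cf_trans d; have:= cf_step_rule [::] [::] Ax; rewrite cats0.
- rewrite ends_finish1 => ex; split=> //; apply: good_replace => t.
  move/(gen_inert _ (finish1_inert c)) => ->; exists (finish1 c); split=> //.
  apply/gen_seq1; exists [:: c]; split=> //; first exact: cf_refl.
  by rewrite /finish /= cats0.
case=> [[a [c [_ -> ->]]]|[c [czo -> ->]]|[-> ->]] ex; split=> //.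
- exact: good_swap.
- exact: good_check.
- by apply: leq_trans ex; rewrite leq_add2l leq_addl.
- apply: good_erase; rewrite ends_cat.
  by move: ex; rewrite addnCA; case: (ends u + ends v).
Qed.

Lemma good_derives w x : ps_derives sim_rules x (map inl w) -> ends x <= 1 -> good w x.
Proof.
move def_y: (map inl w) => y d; elim: d def_y => [x1|x1 y1 z1 st _ IH] def_y ex.
  have inl_w : all inert (map inl w) by elim: (w).
  exists (map inl w); rewrite -def_y; split; first exact/gen_inert.
    by elim: (w) => //= a s ->.
  by left; elim: (w).
by have [ey] := good_step w ex st; apply; apply: IH.
Qed.

Lemma sim_sound w : ps_derives sim_rules [:: inr start] (map inl w) -> L_GF P S z o h w.
Proof.
case/good_derives=> // _ [/gen_seq1[y [d f ->]]].
rewrite -[_ :: _]cat1s pi_T_cat marks_cat pi_T_finish marks_finish => /= eT.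
(* [marks] also keeps the left end, so the alternative without marks is impossible here. *)
case=> // -[u uzo [e]]; exists y; split=> //; last exact/eqP.
exists u; split=> //; apply: (inj_map _ e) => v1 v2 [->].
by [].
Qed.

(** * Completeness of the simulation *)

Lemma sim_pending x y : cf_derives P x y ->
  ps_derives sim_rules (map pending x) (map pending y).
Proof.
elim=> [x1|x1 y1 z1 [u [v [A [r [Ar [-> ->]]]]]] _ IH]; first exact: ps_refl.
apply: ps_derives_comp IH; rewrite !map_cat map_cons -cat1s.
apply: ps_derives_ctx; apply: ps_derives_rule.
rewrite !mem_cat; apply/orP; right; apply/orP; left.
by apply/mapP; exists (A, r).
Qed.

Lemma sim_finish y : finished y ->
  ps_derives sim_rules (map pending y) (finish y).
Proof.
elim: y => [_|v y IH]; first exact: ps_refl.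
rewrite -cat1s finished_cat finish_cat map_cat => /andP[fv /IH].
move/(ps_derives_ctxl (finish [:: v])); apply: ps_derives_comp.
apply: ps_derives_ctxr; apply: ps_derives_rule; rewrite /finish /= cats0.
rewrite !mem_cat; do 2 (apply/orP; right); apply/orP; left.
by apply/mapP; exists v => //; rewrite mem_filter fv mem_enum.
Qed.

Lemma sim_swap a s : all (mem W) s ->
  ps_derives sim_rules (inl a :: map mark s) (map mark s ++ [:: inl a]).
Proof.
elim: s => [_|v s IH]; first exact: ps_refl.
case/andP=> vW /IH /(ps_derives_ctxl [:: mark v]); apply: ps_derives_comp.
apply: (ps_derives_ctxr (map mark s) (x := [:: inl a; mark v]) (y := [:: mark v; inl a])).
apply: ps_derives_rule; rewrite !mem_cat.
do 3 (apply/orP; right); apply/orP; left.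
by apply/allpairsP; exists (a, v); rewrite mem_enum.
Qed.

(** Insertion sort from the right: the mark of [v] already stands in front, and its letter moves
    behind the sorted marks of [y]. *)
Lemma sim_sort y :
  ps_derives sim_rules (finish y) (map mark (pi_X W y) ++ map inl (pi_T y)).
Proof.
elim: y => [|v y IH]; first exact: ps_refl.
have tailP : ps_derives sim_rules ((if v is inl a then [:: inl a] else [::]) ++ finish y)
    (map mark (pi_X W y) ++ map inl (pi_T (v :: y))).
  case: v => [a|A] //=; apply: ps_derives_comp (ps_derives_ctxl [:: inl a] IH) _.
  rewrite -[inl a :: map inl _]cat1s !catA; apply: ps_derives_ctxr.
  by apply: sim_swap; apply: filter_all.
rewrite /finish /= -/(finish y) /finish1 -catA; case: ifP => // _.
exact: (ps_derives_ctxl [:: mark v]).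
Qed.

(** Cancellation works from the centre outwards, hence the induction on the last letter of [u]. *)
Lemma sim_check u : all (mem [:: z; o]) u ->
  ps_derives sim_rules (map mark (u ++ h :: rev u)) [:: mark h].
Proof.
elim/last_ind: u => [_|u c IH]; first exact: ps_refl.
rewrite all_rcons => /andP[czo uzo]; apply: ps_derives_comp (IH uzo).
rewrite rev_rcons cat_rcons !map_cat /= -!/(map mark _).
apply: (ps_derives_ctx _ _ (x := [:: mark c; mark h; mark c]) (y := [:: mark h])).
apply: ps_derives_rule; rewrite !mem_cat.
do 4 (apply/orP; right); apply/orP; left.
by apply/mapP; exists c.
Qed.

Lemma sim_complete w : L_GF P S z o h w -> ps_derives sim_rules [:: inr start] (map inl w).
Proof.
case=> y [Sy [u [uzo mir]] /eqP fy <-].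
apply: (@ps_derives_comp _ _ _ _ [:: left_end; pending (inr S)]).
  by apply: ps_derives_rule; rewrite mem_head.
apply: ps_derives_comp (ps_derives_ctxl [:: left_end] (sim_pending Sy)) _.
apply: ps_derives_comp (ps_derives_ctxl [:: left_end] (sim_finish fy)) _.
apply: ps_derives_comp (ps_derives_ctxl [:: left_end] (sim_sort y)) _.
rewrite mir catA; apply: (ps_derives_ctxr _ (y := [::])).
apply: ps_derives_comp (ps_derives_ctxl [:: left_end] (sim_check uzo)) _.
by apply: ps_derives_rule; rewrite !mem_cat mem_head !orbT.
Qed.

Lemma L_GF_recursively_enumerable : recursively_enumerable (L_GF P S z o h).
Proof.
exists sim_nt, sim_rules, start; split=> [l r|w]; first exact: sim_rules_nonterminal.
by split=> [/sim_complete|/sim_sound].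
Qed.

End LGFisRE.
(** * From phrase-structure grammars to context-free grammars with mirror finalization *)

Section REisLGF.

Variables (Sigma N : finType) (P : seq (seq (Sigma + N) * seq (Sigma + N))) (S : N).

Local Notation V := (Sigma + N)%type.

(* [None] separates consecutive sentential forms. *)
Definition tape : finType := option V.
Definition tiles : seq (seq tape * seq tape) :=
  [seq ([:: x], [:: x]) | x <- enum tape] ++
  [seq (map Some p.1, map Some p.2) | p <- P].
Definition tops (ps : seq (seq tape * seq tape)) := flatten (map fst ps).
Definition bottoms (ps : seq (seq tape * seq tape)) := flatten (map snd ps).

(** The separator [None] does not occur in [map Some l], so the left-hand side of a rule cannot
    straddle two sentential forms. *)
Lemma map_Some_prefix (l s : seq V) (X Y : seq tape) :
  map Some l ++ X = map Some s ++ None :: Y ->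
  exists2 s', s = l ++ s' & X = map Some s' ++ None :: Y.
Proof.
elim: l s => [|a l IH] s /=; first by exists s.
by case: s => [|b s] //= [-> /IH[s' -> ->]]; exists s'.
Qed.

(* The tiles act on a queue, popping a top at the front and pushing the bottom
   at the back; the queue s $ t stands for the sentential form t ++ s. *)
Lemma tiles_sound ps (s t w : seq V) : all (mem tiles) ps ->
  map Some s ++ None :: map Some t ++ bottoms ps =
    tops ps ++ map Some w ++ [:: None] ->
  ps_derives P (t ++ s) w.
Proof.
elim: ps s t => [|[g f] ps IH] s t /=.
  rewrite /bottoms /tops /= cats0 => _ /esym/map_Some_prefix[s' -> /esym].
  case: s' => [|//] [e]; rewrite cats0.
  by case: t e => //= _; apply: ps_refl.
rewrite /bottoms /tops /= -/(bottoms ps) -/(tops ps) -catA => /andP[gf psP].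
move: gf; rewrite mem_cat => /orP[/mapP[[x|] _ [-> ->]]|/mapP[[l r] lr [-> ->]]] /=.
(* A copied symbol passes from the front of [s] to the end of [t], leaving [t ++ s] unchanged. *)
- move/esym/(map_Some_prefix (l := [:: x])) => [s' -> /esym e].
  rewrite -cat1s catA; apply: IH => //.
  by rewrite map_cat -catA.
(* The separator reaches the front only when [s] is used up; [t] then becomes the new front. *)
- case: s => [|//] /= [e]; rewrite cats0; apply: (IH t [::]) => //.
- move/esym/map_Some_prefix => [s' -> /esym e].
  apply: (@ps_trans _ _ _ _ (t ++ r ++ s')); first by exists t, s', l, r.
  by rewrite catA; apply: IH => //; rewrite map_cat -catA.
Qed.

Lemma tiles_complete (x w : seq V) : ps_derives P x w ->
  exists2 ps, all (mem tiles) ps &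
    map Some x ++ None :: bottoms ps = tops ps ++ map Some w ++ [:: None].
Proof.
elim=> [x1|_ _ z1 [u [v [l [r [lr [-> ->]]]]]] _ [ps psP e]]; first by exists [::].
pose copy (s : seq V) : seq (seq tape * seq tape) := [seq ([:: Some c], [:: Some c]) | c <- s].
have copyP c : ([:: c], [:: c]) \in tiles.
  by rewrite mem_cat; apply/orP; left; apply/mapP; exists c; rewrite ?mem_enum.
have copy_all s : all (mem tiles) (copy s).
  by rewrite all_map; apply/allP=> c _; apply: copyP.
have copy_tops s : tops (copy s) = map Some s by rewrite /tops; elim: s => //= c s ->.
have copy_bottoms s : bottoms (copy s) = map Some s by rewrite /bottoms; elim: s => //= c s ->.
have topsD p1 p2 : tops (p1 ++ p2) = tops p1 ++ tops p2 by rewrite /tops map_cat flatten_cat.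
have bottomsD p1 p2 : bottoms (p1 ++ p2) = bottoms p1 ++ bottoms p2.
  by rewrite /bottoms map_cat flatten_cat.
(* One derivation step is one full turn of the queue: copy the context, apply the rule once, copy
   the separator. *)
exists (copy u ++ [:: (map Some l, map Some r)] ++ copy v ++ [:: ([:: None], [:: None])] ++ ps).
  rewrite !all_cat !copy_all psP /= copyP !andbT mem_cat; apply/orP; right.
  by apply/mapP; exists (l, r).
rewrite !topsD !bottomsD !copy_tops !copy_bottoms /tops /bottoms /= -/(tops ps) -/(bottoms ps).
by rewrite !cats0 !map_cat -!catA /= -e !map_cat -!catA.
Qed.

(* Left summand: control states (initial, running, halting); right summand: the
   three symbols of the finalizing alphabet, which no rule rewrites. *)
Definition lin_nt : finType := (option bool + option bool)%type.
Definition init : lin_nt := inl None.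
Definition run : lin_nt := inl (Some true).
Definition halt : lin_nt := inl (Some false).
Definition zero : Sigma + lin_nt := inr (inr (Some false)).
Definition one : Sigma + lin_nt := inr (inr (Some true)).
Definition hash : Sigma + lin_nt := inr (inr None).

Local Notation W := [:: zero; one; hash].

(** A prefix code: the rank in unary, closed by [one]. *)
Definition code (x : tape) : seq (Sigma + lin_nt) :=
  rcons (nseq (enum_rank x) zero) one.
Definition codes (s : seq tape) := flatten (map code s).
Definition emit (w : seq Sigma) : seq (Sigma + lin_nt) :=
  flatten [seq inl a :: code (Some (inl a)) | a <- w].

(** The head start of the bottoms: the first sentential form, which no tile produces. *)
Definition queue0 : seq tape := [:: Some (inr S); None].

Definition lin_rules : seq (lin_nt * seq (Sigma + lin_nt)) :=
  [:: (init, inr run :: rev (codes queue0));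
      (run, [:: inr halt]);
      (halt, code None ++ [:: hash])] ++
  [seq (run, codes p.1 ++ inr run :: rev (codes p.2)) | p <- tiles] ++
  [seq (halt, inl a :: code (Some (inl a)) ++ [:: inr halt]) | a <- enum Sigma].

Lemma lin_propagating : propagating lin_rules.
Proof.
move=> A r; rewrite !mem_cat !inE => /orP[/or3P[]/eqP[_ ->] //|/orP[]/mapP[p _ [_ ->]] //].
- by case: code.
- by case: codes.
Qed.

Lemma codes_cat s t : codes (s ++ t) = codes s ++ codes t.
Proof. by rewrite /codes map_cat flatten_cat. Qed.

Lemma codes_inj : injective codes.
Proof.
(* The first [one] ends the first code, so the leading zeros determine the rank. *)
have code_cons n m (s t : seq (Sigma + lin_nt)) :
    nseq n zero ++ one :: s = nseq m zero ++ one :: t -> n = m /\ s = t.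
  elim: n m => [|n IH] [|m] //=; first by case.
  by case=> /IH[-> ->].
elim=> [|x s IH] [|y t] //=; rewrite /codes /= -?/(codes _) /code ?cat_rcons.
- by case: (nat_of_ord _).
- by case: (nat_of_ord _).
- by case/code_cons=> /val_inj/enum_rank_inj -> /IH ->.
Qed.

(** * Sentential forms of the linear grammar *)

Definition passive (s : Sigma + lin_nt) : bool :=
  if s is inr (inl _) then false else true.

(** [W] exhausts the right summand of [lin_nt], so the nonterminals outside it are exactly the
    control states. *)
Lemma passiveP y : pi_NminusW W y = [::] <-> all passive y.
Proof.
elim: y => //= s y IH.
by case: s => [a|[q|[[]|]]] /=.
Qed.

Lemma codes_binary s : all (mem [:: zero; one]) (codes s).
Proof.
elim: s => //= x s IH; rewrite /codes /= -/(codes s) all_cat IH all_rcons all_nseq.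
by rewrite orbT.
Qed.

Lemma binary_passive u : all (mem [:: zero; one]) u -> all passive u.
Proof. by apply: sub_all => -[a|[q|[[]|]]]. Qed.

Lemma codes_passive s : all passive (codes s).
Proof. exact/binary_passive/codes_binary. Qed.

Lemma code_passive x : all passive (code x).
Proof. by have := codes_passive [:: x]; rewrite /codes /= cats0. Qed.

(** Makes the place of rewriting unique: a form with a single control state splits around it in one
    way only. *)
Lemma passive_pivot u v u' v' q q' : all passive u -> all passive v ->
  u ++ inr (inl q) :: v = u' ++ inr (inl q') :: v' -> [/\ u = u', q = q' & v = v'].
Proof.
move=> + pv; elim: u u' => [|s u IH] [|s' u'] /=.
- by move=> _ [-> ->].
- by move=> _ [_ e]; move: pv; rewrite e all_cat /= andbF.
- by move=> + [e]; rewrite e.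
- by case/andP=> _ /IH {}IH [-> /IH[-> -> ->]].
Qed.

Lemma lin_rules_control A r : (A, r) \in lin_rules -> exists q, A = inl q.
Proof.
rewrite !mem_cat !inE.
by move=> /orP[/or3P[]/eqP[-> _]|/orP[]/mapP[p _ [-> _]]]; eexists.
Qed.

Lemma passive_final x y : all passive x -> cf_derives lin_rules x y -> y = x.
Proof.
move=> + d; case: d => // {y}x' _ z [u [v [A [r [/lin_rules_control[q ->] [-> _]]]]]] _.
by rewrite all_cat /= andbF.
Qed.

Lemma lin_step u v q y : all passive u -> all passive v ->
  cf_step lin_rules (u ++ inr (inl q) :: v) y ->
  exists2 r, (inl q, r) \in lin_rules & y = u ++ r ++ v.
Proof.
move=> pu pv [u' [v' [A [r [Ar [e ->]]]]]].
have [q' def_A] := lin_rules_control Ar.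
rewrite def_A in Ar e; have [-> -> ->] := passive_pivot pu pv e.
by exists r.
Qed.

(** Each emitting step lengthens the passive prefix [u], over which the induction is generalized;
    the closing rule leaves no control state and so ends the derivation. *)
Lemma halt_sound u v y : cf_derives lin_rules (u ++ inr halt :: v) y ->
  all passive u -> all passive v -> all passive y ->
  exists w, y = u ++ emit w ++ code None ++ hash :: v.
Proof.
move def_x: (_ ++ _) => x d; elim: d u def_x => {x y}[x|x y z st d IH] u def_x pu pv pz.
  by move: pz; rewrite -def_x all_cat /= andbF.
rewrite -def_x in st; have [r + def_y] := lin_step pu pv st.
rewrite !mem_cat !inE => /orP[/or3P[]/eqP // [def_r]|/orP[]/mapP[//a _ [def_r]]].
  exists [::]; rewrite def_r -!catA in def_y; rewrite -def_y.
  apply: passive_final d; rewrite def_y !all_cat pu code_passive.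
  exact: pv.
have [w ->] : exists w, z = (u ++ inl a :: code (Some (inl a))) ++ emit w ++ code None ++ hash :: v.
  apply: IH => //; first by rewrite def_y def_r -?catA /= -?catA.
  by rewrite all_cat pu /= code_passive.
by exists (a :: w); rewrite /emit /= -?catA /= -?catA.
Qed.

(** The contribution of [run] alone; the part due to [init] stays outside on the right. *)
Definition lin_form ps w : seq (Sigma + lin_nt) :=
  codes (tops ps) ++ emit w ++ code None ++ hash :: rev (codes (bottoms ps)).

(** Tiles are laid from the outside inwards, so the tops appear in order on the left and the bottoms
    in reverse order on the right. *)
Lemma run_sound u v y : cf_derives lin_rules (u ++ inr run :: v) y ->
  all passive u -> all passive v -> all passive y ->
  exists2 ps, all (mem tiles) ps & exists w, y = u ++ lin_form ps w ++ v.
Proof.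
move def_x: (_ ++ _) => x d; elim: d u v def_x => {x y}[x|x y z st d IH] u v def_x pu pv pz.
  by move: pz; rewrite -def_x all_cat /= andbF.
rewrite -def_x in st; have [r + def_y] := lin_step pu pv st.
rewrite !mem_cat !inE => /orP[/or3P[]/eqP // [def_r]|/orP[]/mapP[//p pt [def_r]]].
  rewrite def_y def_r in d; have [w ->] := halt_sound d pu pv pz.
  by exists [::] => //; exists w; rewrite /lin_form /= -!catA.
have [||||ps psP [w ->]] := IH (u ++ codes p.1) (rev (codes p.2) ++ v).
- by rewrite def_y def_r -?catA /= -?catA.
- by rewrite all_cat pu codes_passive.
- by rewrite all_cat all_rev pv codes_passive.
- exact: pz.
exists (p :: ps); first by rewrite /= pt.
exists w; rewrite /lin_form /tops /bottoms /= !codes_cat rev_cat -?catA /= -?catA.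
by rewrite -?catA /= -?catA.
Qed.

Lemma lin_sound y : phi lin_rules init y -> all passive y ->
  exists2 ps, all (mem tiles) ps & exists w, y = lin_form ps w ++ rev (codes queue0).
Proof.
rewrite /phi; move def_x: [:: _] => x d; case: d def_x => {x y}[x|x y z st d] def_x pz.
  by rewrite -def_x in pz.
(* The argument [None] is the control state of [init]. *)
rewrite -def_x in st; have [r + def_y] := @lin_step [::] [::] None y isT isT st.
rewrite !mem_cat !inE => /orP[/or3P[]/eqP // [def_r]|/orP[]/mapP[//]].
rewrite def_y def_r cats0 in d.
by apply: (run_sound (u := [::]) d); rewrite ?all_rev ?codes_passive.
Qed.

Lemma lin_complete ps w : all (mem tiles) ps ->
  phi lin_rules init (lin_form ps w ++ rev (codes queue0)).
Proof.
move=> psP; have halt_emit u v : cf_derives lin_rules (u ++ inr halt :: v)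
    (u ++ emit w ++ code None ++ hash :: v).
  elim: w u => [|a w IH] u.
    apply: cf_trans (cf_refl _ _).
    have := @cf_step_rule _ _ lin_rules halt (code None ++ [:: hash]) u v.
    by rewrite -catA; apply; rewrite !inE eqxx !orbT.
  have := IH (u ++ inl a :: code (Some (inl a))).
  rewrite /emit /= -?catA /= -?catA; apply: cf_trans.
  have := @cf_step_rule _ _ lin_rules halt (inl a :: code (Some (inl a)) ++ [:: inr halt]) u v.
  rewrite /= -!catA; apply; rewrite !mem_cat; apply/orP; right; apply/orP; right.
  by apply/mapP; exists a; rewrite ?mem_enum.
have run_tiles u v : cf_derives lin_rules (u ++ inr run :: v) (u ++ lin_form ps w ++ v).
  elim: ps psP u v => [_|p ps IH /andP[pt /IH{}IH]] u v.
    apply: (@cf_trans _ _ _ _ (u ++ [:: inr halt] ++ v)).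
      by apply: cf_step_rule; rewrite !inE eqxx !orbT.
    by rewrite /lin_form /= -!catA; apply: halt_emit.
  apply: (@cf_trans _ _ _ _ (u ++ (codes p.1 ++ inr run :: rev (codes p.2)) ++ v)).
    apply: cf_step_rule; rewrite !mem_cat; apply/orP; right; apply/orP; left.
    by apply/mapP; exists p.
  have := IH (u ++ codes p.1) (rev (codes p.2) ++ v).
  by rewrite /lin_form /tops /bottoms /= !codes_cat rev_cat -?catA /= -?catA.
apply: (@cf_trans _ _ _ _ (inr run :: rev (codes queue0))); last exact: (run_tiles [::]).
have := @cf_step_rule _ _ lin_rules init (inr run :: rev (codes queue0)) [::] [::].
by rewrite cats0; apply; rewrite inE eqxx.
Qed.

(** * The mirror condition as a match of tiles *)

Lemma pi_W_codes s : pi_X W (codes s) = codes s.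
Proof.
apply/all_filterP; apply: sub_all (codes_binary s) => x /=.
by rewrite !inE => /orP[]->; rewrite ?orbT.
Qed.

Lemma pi_W_emit w : pi_X W (emit w) = codes (map (Some \o inl) w).
Proof.
elim: w => //= a w IH; rewrite /emit /codes /= -/(emit w) -/(codes _) /pi_X filter_cat.
by rewrite -!/(pi_X _ _) IH; have := pi_W_codes [:: Some (inl a)]; rewrite /codes /= cats0 => ->.
Qed.

Lemma pi_T_passive_binary u : all (mem [:: zero; one]) u -> pi_T u = [::].
Proof. by elim: u => //= -[a|[q|[[]|]]] u IH /andP[]. Qed.

Lemma pi_T_emit w : pi_T (emit w) = w.
Proof.
elim: w => //= a w IH; rewrite /emit /= -/(emit w) pi_T_cat IH.
have := codes_binary [:: Some (inl a)]; rewrite /codes /= cats0.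
by move/pi_T_passive_binary ->.
Qed.

Lemma pi_T_lin_form ps w : pi_T (lin_form ps w ++ rev (codes queue0)) = w.
Proof.
have e s : pi_T (codes s) = [::] by apply/pi_T_passive_binary/codes_binary.
have er s : pi_T (rev (codes s)) = [::].
  by apply: pi_T_passive_binary; rewrite all_rev codes_binary.
have e0 : pi_T (code None) = [::] by rewrite -(e [:: None]) /codes /= cats0.
by rewrite !pi_T_cat e e0 -[hash :: _]cat1s pi_T_cat !er pi_T_emit /= !cats0.
Qed.

(** Erasing the letters from [emit w] leaves their codes, so the left side spells the tops followed
    by the last sentential form, and the two reversed pieces on the right merge into one queue. *)
Lemma pi_W_lin_form ps w : pi_X W (lin_form ps w ++ rev (codes queue0)) =
  codes (tops ps ++ map (Some \o inl) w ++ [:: None]) ++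
    hash :: rev (codes (queue0 ++ bottoms ps)).
Proof.
have pi_W_rev s : pi_X W (rev (codes s)) = rev (codes s).
  by rewrite /pi_X filter_rev -/(pi_X _ _) pi_W_codes.
have e0 : codes [:: None] = code None by rewrite /codes /= cats0.
have pi_code0 : pi_X W (code None) = code None by rewrite -e0 pi_W_codes.
have piD x y : pi_X W (x ++ y) = pi_X W x ++ pi_X W y by apply: filter_cat.
have pi_hash s : pi_X W (hash :: s) = hash :: pi_X W s by [].
rewrite (codes_cat (tops ps)) (codes_cat (map _ w)) e0 (codes_cat queue0) rev_cat.
rewrite !piD pi_hash !pi_W_codes !pi_W_rev pi_W_emit pi_code0.
by rewrite -!catA cat_cons.
Qed.

Lemma lin_form_passive ps w : all passive (lin_form ps w ++ rev (codes queue0)).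
Proof.
rewrite !all_cat !code_passive /= codes_passive !all_rev !codes_passive !andbT.
elim: w => //= a w IH; rewrite /emit /= -/(emit w).
by rewrite all_cat IH code_passive.
Qed.

(** No code contains [hash], so the centre of the mirror is forced; unique decoding then turns
    equality of codes into equality of tapes. *)
Lemma lin_mirror ps w :
  F_mirror zero one hash (pi_X W (lin_form ps w ++ rev (codes queue0))) <->
  tops ps ++ map (Some \o inl) w ++ [:: None] = queue0 ++ bottoms ps.
Proof.
rewrite pi_W_lin_form; split=> [[u [ub /eqP]]|->]; last first.
  by exists (codes (queue0 ++ bottoms ps)); rewrite codes_binary.
have hashN s : all (mem [:: zero; one]) s -> hash \notin s.
  by move/allP=> sP; apply/negP=> /sP.
rewrite eqseq_pivotl ?hashN ?all_rev ?codes_binary //.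
case/andP=> /eqP <- /eqP /(can_inj (@revK _)) /esym.
exact: codes_inj.
Qed.

Lemma lin_L_GF w : L_GF lin_rules init zero one hash w <->
  ps_derives P [:: inr S] (map inl w).
Proof.
split=> [[y [/lin_sound ySound + /passiveP yp]]|].
  have [ps psP [w' ->]] := ySound yp; rewrite pi_T_lin_form => /lin_mirror e <-.
  (* [queue0] is the queue of the one-symbol form [S] with nothing pushed yet. *)
  apply: (tiles_sound (t := [::]) psP); rewrite -map_comp.
  exact/esym.
case/tiles_complete=> ps psP e; exists (lin_form ps w ++ rev (codes queue0)).
rewrite pi_T_lin_form; split=> //; first exact: lin_complete.
  by apply/lin_mirror; rewrite -map_comp in e; apply/esym.
exact/passiveP/lin_form_passive.
Qed.

End REisLGF.

Theorem theorem2 (Sigma : finType) (L : seq Sigma -> Prop) :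
  recursively_enumerable L <->
  exists (N : finType) (P : seq (N * seq (Sigma + N))) (S : N) (z o h : Sigma + N),
    [/\ uniq [:: z; o; h], propagating P & forall w, L w <-> L_GF P S z o h w].
Proof.
split=> [[N [P [S [_ LP]]]]|[N [P [S [z [o [h [uzoh _ LP]]]]]]]].
  exists (lin_nt : finType), (lin_rules P S), init, (zero _), (one _), (hash _).
  split=> // [|w]; first exact: lin_propagating.
  exact: iff_trans (LP w) (iff_sym (lin_L_GF P S w)).
have [N' [P' [S' [ntP' simP]]]] := L_GF_recursively_enumerable P S uzoh.
exists N', P', S'; split=> // w.
exact: iff_trans (LP w) (simP w).
Qed.
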